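(* Let $R$ be a reduced commutative noetherian ring and let $M$ be a finitely generated faithful torsion-free $R$-module. Then the centre of $\mathrm{End}_R M$ is the largest finite extension of $R$ which is an $R$-algebra and over which $M$ is a module, i.e., the largest ring $S$ such that $R\subseteq S\subseteq Q(R)$ and $SM=M$.
   Context: $Q(R)$ is the total quotient ring of $R$. Since $M$ is torsion-free, $M$ embeds in $Q(R)M:=Q(R)\otimes_R M$, and for a ring $R\subseteq S\subseteq Q(R)$ the product $SM$ is formed inside $Q(R)M$. The centre of $\mathrm{End}_R M$ is viewed inside $Q(R)$ via $\mathrm{End}_RM\subseteq \mathrm{End}_{Q(R)}(Q(R)\otimes_R M)$. *)

(* Defs.v *)
From HB Require Import structures.
From mathcomp Require Import all_boot all_algebra.
From mathcomp Require Import ring.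
From mathcomp Require Import boolp classical_sets.

Set Implicit Arguments.
Unset Strict Implicit.
Unset Printing Implicit Defensive.

Import GRing.Theory.
Local Open Scope ring_scope.
Local Open Scope classical_set_scope.
Local Open Scope quotient_scope.

(* [comPzRingType] allows the zero ring; [GRing.lreg s] says that s is a
   non-zero-divisor (equivalently a regular element, R being commutative). *)

Section TotalQuotient.
Variable R : comPzRingType.

Record tratio := Tratio
  { rnum : R; rden : R; rdenP : `[< @GRing.lreg R rden >] }.

Definition tratio_pair (x : tratio) :
    {p : R * R | `[< @GRing.lreg R p.2 >]} :=
  exist _ (rnum x, rden x) (rdenP x).
Definition pair_tratio (p : {p : R * R | `[< @GRing.lreg R p.2 >]}) : tratio :=
  let: exist nd ndP := p in @Tratio nd.1 nd.2 ndP.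
Lemma tratio_pairK : cancel tratio_pair pair_tratio.
Proof. by case=> n d dP. Qed.
HB.instance Definition _ := Choice.copy tratio (can_type tratio_pairK).

Lemma rden_reg (x : tratio) : @GRing.lreg R (rden x).
Proof. exact/asboolP/rdenP. Qed.

Definition req (x y : tratio) := rnum x * rden y == rnum y * rden x.

Lemma req_refl : reflexive req. Proof. by move=> x; rewrite /req. Qed.
Lemma req_sym : symmetric req. Proof. by move=> x y; rewrite /req eq_sym. Qed.
Lemma req_trans : transitive req.
Proof.
move=> y x z; rewrite /req => /eqP xy /eqP yz; apply/eqP/(@rden_reg y).
transitivity (rnum x * rden y * rden z); first by ring.
rewrite xy; transitivity (rnum y * rden z * rden x); first by ring.
by rewrite yz; ring.
Qed.

Canonical req_equiv := EquivRel req req_refl req_sym req_trans.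

(* the total quotient ring Q(R) *)
Definition tquot := {eq_quot req}.
HB.instance Definition _ := EqQuotient.on tquot.
HB.instance Definition _ := Choice.on tquot.

Lemma lregMb (s t : R) : `[< @GRing.lreg R s >] -> `[< @GRing.lreg R t >] ->
  `[< @GRing.lreg R (s * t) >].
Proof. by move=> /asboolP ? /asboolP ?; apply/asboolP/lregM. Qed.
Lemma lreg1b : `[< @GRing.lreg R 1 >].
Proof. exact/asboolP/lreg1. Qed.

Definition rint (a : R) := @Tratio a 1 lreg1b.
Definition radd (x y : tratio) :=
  @Tratio (rnum x * rden y + rnum y * rden x) (rden x * rden y)
    (lregMb (rdenP x) (rdenP y)).
Definition ropp (x : tratio) := @Tratio (- rnum x) (rden x) (rdenP x).
Definition rmul (x y : tratio) :=
  @Tratio (rnum x * rnum y) (rden x * rden y) (lregMb (rdenP x) (rdenP y)).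

Definition to_tquot (a : R) : tquot := \pi_tquot (rint a).
Definition tadd := lift_op2 tquot radd.
Definition topp := lift_op1 tquot ropp.
Definition tmul := lift_op2 tquot rmul.

Lemma req_repr x : rnum (repr (\pi_tquot x)) * rden x =
                   rnum x * rden (repr (\pi_tquot x)).
Proof. by apply/eqP; rewrite -[_ == _]/(req _ _) -eqmodE reprK. Qed.

Lemma pi_eq x y :
  rnum x * rden y = rnum y * rden x -> \pi_tquot x = \pi_tquot y.
Proof. by move=> e; apply/eqmodP; rewrite /= /req e. Qed.

Lemma tadd_pi x y : tadd (\pi_tquot x) (\pi_tquot y) = \pi_tquot (radd x y).
Proof.
unlock tadd; apply: pi_eq; rewrite /radd /=.
have ex := req_repr x; have ey := req_repr y; move: ex ey.
set x' := repr _; set y' := repr _ => ex ey.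
transitivity (rnum x' * rden x * (rden y * rden y') +
  rnum y' * rden y * (rden x * rden x')); first by ring.
by rewrite ex ey; ring.
Qed.

Lemma topp_pi x : topp (\pi_tquot x) = \pi_tquot (ropp x).
Proof. by unlock topp; apply: pi_eq; rewrite /= !mulNr req_repr. Qed.

Lemma tmul_pi x y : tmul (\pi_tquot x) (\pi_tquot y) = \pi_tquot (rmul x y).
Proof. by unlock tmul; apply: pi_eq; rewrite /= mulrACA !req_repr mulrACA. Qed.

Lemma taddA : associative tadd.
Proof.
elim/quotW=> x; elim/quotW=> y; elim/quotW=> z; rewrite !tadd_pi.
by apply: pi_eq => /=; ring.
Qed.
Lemma taddC : commutative tadd.
Proof.
by elim/quotW=> x; elim/quotW=> y; rewrite !tadd_pi; apply: pi_eq => /=; ring.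
Qed.
Lemma tadd0 : left_id (to_tquot 0) tadd.
Proof. by elim/quotW=> x; rewrite tadd_pi; apply: pi_eq => /=; ring. Qed.
Lemma taddN : left_inverse (to_tquot 0) topp tadd.
Proof.
by elim/quotW=> x; rewrite topp_pi tadd_pi; apply: pi_eq => /=; ring.
Qed.
HB.instance Definition _ := GRing.isZmodule.Build tquot taddA taddC tadd0 taddN.

Lemma tmulA : associative tmul.
Proof.
elim/quotW=> x; elim/quotW=> y; elim/quotW=> z; rewrite !tmul_pi.
by apply: pi_eq => /=; ring.
Qed.
Lemma tmulC : commutative tmul.
Proof.
by elim/quotW=> x; elim/quotW=> y; rewrite !tmul_pi; apply: pi_eq => /=; ring.
Qed.
Lemma tmul1 : left_id (to_tquot 1) tmul.
Proof. by elim/quotW=> x; rewrite tmul_pi; apply: pi_eq => /=; ring. Qed.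
Lemma tmulDl : left_distributive tmul tadd.
Proof.
elim/quotW=> x; elim/quotW=> y; elim/quotW=> z.
by rewrite !(tmul_pi, tadd_pi); apply: pi_eq => /=; ring.
Qed.
HB.instance Definition _ :=
  GRing.Zmodule_isComPzRing.Build tquot tmulA tmulC tmul1 tmulDl.

Lemma to_tquot_zmod : zmod_morphism to_tquot.
Proof.
move=> a b; rewrite -[RHS]/(tadd _ (topp _)) topp_pi tadd_pi.
by apply: pi_eq => /=; ring.
Qed.
HB.instance Definition _ :=
  GRing.isZmodMorphism.Build R tquot to_tquot to_tquot_zmod.
Lemma to_tquot_monoid : monoid_morphism to_tquot.
Proof.
split=> // a b; rewrite -[RHS]/(tmul _ _) tmul_pi.
by apply: pi_eq => /=; ring.
Qed.
HB.instance Definition _ :=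
  GRing.isMonoidMorphism.Build R tquot to_tquot to_tquot_monoid.

Definition tscale (a : R) (x : tquot) : tquot := to_tquot a * x.
Lemma tscaleA a b x : tscale a (tscale b x) = tscale (a * b) x.
Proof. by rewrite /tscale rmorphM mulrA. Qed.
Lemma tscale1 : left_id 1 tscale.
Proof. by move=> x; rewrite /tscale rmorph1 mul1r. Qed.
Lemma tscaleDr : right_distributive tscale +%R.
Proof. by move=> a x y; rewrite /tscale mulrDr. Qed.
Lemma tscaleDl x : {morph tscale^~ x : a b / a + b}.
Proof. by move=> a b; rewrite /tscale rmorphD mulrDl. Qed.
HB.instance Definition _ :=
  GRing.Zmodule_isLmodule.Build R tquot tscaleA tscale1 tscaleDr tscaleDl.

Lemma to_tquot_inj : injective to_tquot.
Proof. by move=> a b /eqmodP /=; rewrite /req /= !mulr1 => /eqP. Qed.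

Lemma to_tquot_reg (s : R) :
  GRing.lreg s -> exists x : tquot, to_tquot s * x = 1.
Proof.
move=> /asboolP sreg; exists (\pi_tquot (@Tratio 1 s sreg)).
by rewrite -[LHS]/(tmul _ _) tmul_pi; apply: pi_eq => /=; ring.
Qed.

Lemma tquotP (x : tquot) :
  exists a s : R, GRing.lreg s /\ to_tquot s * x = to_tquot a.
Proof.
elim/quotW: x => x; exists (rnum x), (rden x); split; first exact: rden_reg.
by rewrite -[LHS]/(tmul _ _) tmul_pi; apply: pi_eq => /=; ring.
Qed.

End TotalQuotient.

Section Tensor.
Variables (R : comPzRingType) (N M : lmodType R).

Definition balanced (V : zmodType) (b : N -> M -> V) :=
  [/\ forall n n' m, b (n + n') m = b n m + b n' m,
      forall n m m', b n (m + m') = b n m + b n m' &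
      forall r n m, b (r *: n) m = b n (r *: m)].

Definition bsum (V : zmodType) (b : N -> M -> V) (x : seq (N * M)) : V :=
  \sum_(p <- x) b p.1 p.2.

(* A formal sum of pairs is zero in N (x) M iff every balanced map kills it;
   the universal property is lemmas [tens_balanced] and [tens_univ] below. *)
Definition tens_eq (x y : seq (N * M)) : bool :=
  `[< forall (V : zmodType) (b : N -> M -> V),
        balanced b -> bsum b x = bsum b y >].

Lemma tens_eq_refl : reflexive tens_eq.
Proof. by move=> x; apply/asboolP. Qed.
Lemma tens_eq_sym : symmetric tens_eq.
Proof.
by move=> x y; apply/asboolP/asboolP => h V b bb; rewrite (h V b bb).
Qed.
Lemma tens_eq_trans : transitive tens_eq.
Proof.
move=> y x z /asboolP xy /asboolP yz; apply/asboolP => V b bb.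
by rewrite (xy V b bb) (yz V b bb).
Qed.
Canonical tens_equiv := EquivRel tens_eq tens_eq_refl tens_eq_sym tens_eq_trans.

Definition tensor := {eq_quot tens_eq}.
HB.instance Definition _ := EqQuotient.on tensor.
HB.instance Definition _ := Choice.on tensor.

Lemma tens_piP (x y : seq (N * M)) :
  (forall (V : zmodType) (b : N -> M -> V),
     balanced b -> bsum b x = bsum b y) <-> \pi_tensor x = \pi_tensor y.
Proof. by split=> [h|/eqmodP/asboolP//]; apply/eqmodP/asboolP. Qed.

Lemma bsum_repr (V : zmodType) (b : N -> M -> V) x :
  balanced b -> bsum b (repr (\pi_tensor x)) = bsum b x.
Proof. by move: V b; apply/tens_piP; rewrite reprK. Qed.

Definition tens_opps (x : seq (N * M)) := [seq (- p.1, p.2) | p <- x].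

Definition tens_add := lift_op2 tensor (@cat (N * M)).
Definition tens_opp := lift_op1 tensor tens_opps.

Lemma bsum_cat (V : zmodType) (b : N -> M -> V) x y :
  bsum b (x ++ y) = bsum b x + bsum b y.
Proof. by rewrite /bsum big_cat. Qed.

Lemma bsum_opps (V : zmodType) (b : N -> M -> V) x :
  balanced b -> bsum b (tens_opps x) = - bsum b x.
Proof.
case=> bD _ _; rewrite /bsum big_map -sumrN; apply: eq_bigr => -[n m] _ /=.
apply/eqP; rewrite -addr_eq0 -bD addNr; apply/eqP.
by apply: (@addrI _ (b 0 m)); rewrite -bD !addr0.
Qed.

Lemma tens_add_pi x y :
  tens_add (\pi_tensor x) (\pi_tensor y) = \pi_tensor (x ++ y).
Proof.
unlock tens_add; apply/tens_piP => V b bb.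
by rewrite !bsum_cat !bsum_repr.
Qed.
Lemma tens_opp_pi x : tens_opp (\pi_tensor x) = \pi_tensor (tens_opps x).
Proof.
unlock tens_opp; apply/tens_piP => V b bb.
by rewrite !bsum_opps ?bsum_repr.
Qed.

Lemma tens_addA : associative tens_add.
Proof.
by elim/quotW=> x; elim/quotW=> y; elim/quotW=> z; rewrite !tens_add_pi catA.
Qed.
Lemma tens_addC : commutative tens_add.
Proof.
elim/quotW=> x; elim/quotW=> y; rewrite !tens_add_pi.
by apply/tens_piP => V b bb; rewrite !bsum_cat addrC.
Qed.
Lemma tens_add0 : left_id (\pi_tensor [::]) tens_add.
Proof. by elim/quotW=> x; rewrite tens_add_pi. Qed.
Lemma tens_addN : left_inverse (\pi_tensor [::]) tens_opp tens_add.
Proof.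
elim/quotW=> x; rewrite tens_opp_pi tens_add_pi; apply/tens_piP => V b bb.
by rewrite bsum_cat bsum_opps // addNr /bsum big_nil.
Qed.
HB.instance Definition _ :=
  GRing.isZmodule.Build tensor tens_addA tens_addC tens_add0 tens_addN.

Definition tens (n : N) (m : M) : tensor := \pi_tensor [:: (n, m)].

Lemma bsum_tens x : bsum tens x = \pi_tensor x.
Proof.
elim: x => [|[n m] x IHx]; first by rewrite /bsum big_nil.
rewrite -cat1s bsum_cat IHx {1}/bsum big_seq1.
by rewrite -[LHS]/(tens_add _ _) tens_add_pi.
Qed.

Lemma tens_balanced : balanced tens.
Proof.
by split=> [n n' m|n m m'|r n m]; rewrite -?[RHS]/(tens_add _ _) ?tens_add_pi;
  apply/tens_piP => V b [bDl bDr bZ];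
  rewrite /bsum !(big_cons, big_nil) /= ?addr0.
Qed.

Lemma tens_univ (V : zmodType) (b : N -> M -> V) : balanced b ->
  exists! f : tensor -> V,
    {morph f : x y / x + y} /\ forall n m, f (tens n m) = b n m.
Proof.
move=> bb; exists (fun x => bsum b (repr x)); split; first split.
- elim/quotW=> x; elim/quotW=> y; rewrite -[X in repr X]/(tens_add _ _).
  by rewrite tens_add_pi !bsum_repr // bsum_cat.
- by move=> n m; rewrite bsum_repr // /bsum big_seq1.
move=> g [gD gt]; apply/funext; elim/quotW=> x; rewrite bsum_repr // -bsum_tens.
have g0 : g 0 = 0 by apply: (@addrI _ (g 0)); rewrite -gD !addr0.
rewrite /bsum (big_morph g gD g0); apply: eq_bigr => p _.
by rewrite gt.
Qed.

End Tensor.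

Section ScalarExtension.
Variables (R : comPzRingType) (M : lmodType R).
Local Notation Q := (tquot R).
Local Notation QM := (tensor Q M).

Definition tens_scales (q : Q) (x : seq (Q * M)) :=
  [seq (q * p.1, p.2) | p <- x].
Definition tens_scale (q : Q) := lift_op1 QM (tens_scales q).

Lemma tens_scale_pi q x :
  tens_scale q (\pi_QM x) = \pi_QM (tens_scales q x).
Proof.
unlock tens_scale; apply/tens_piP => V b [bDl bDr bZ].
rewrite /bsum !big_map /=.
apply: (@bsum_repr _ _ _ V (fun n m => b (q * n) m)); split=> *.
- by rewrite mulrDr bDl.
- by rewrite bDr.
- by rewrite -bZ; congr (b _ _); rewrite -![_ *: _]/(to_tquot _ * _) mulrCA.
Qed.

Lemma tens_scaleA a b x : tens_scale a (tens_scale b x) = tens_scale (a * b) x.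
Proof.
elim/quotW: x => x; rewrite !tens_scale_pi /tens_scales -map_comp.
congr (\pi_QM _).
by apply: eq_map => -[n m] /=; rewrite mulrA.
Qed.
Lemma tens_scale1 : left_id 1 tens_scale.
Proof.
elim/quotW=> x; rewrite tens_scale_pi /tens_scales; congr (\pi_QM _).
by rewrite -[RHS]map_id; apply: eq_map => -[n m] /=; rewrite mul1r.
Qed.
Lemma tens_scaleDr : right_distributive tens_scale +%R.
Proof.
move=> q; elim/quotW=> x; elim/quotW=> y.
rewrite -[_ + _ in LHS]/(tens_add _ _) -[RHS]/(tens_add _ _).
by rewrite tens_add_pi !tens_scale_pi tens_add_pi /tens_scales map_cat.
Qed.
Lemma tens_scaleDl x : {morph tens_scale^~ x : a b / a + b}.
Proof.
elim/quotW: x => x a b; rewrite -[RHS]/(tens_add _ _) !tens_scale_pi.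
rewrite tens_add_pi; apply/tens_piP => V c [cDl _ _].
rewrite bsum_cat /bsum !big_map -big_split /=; apply: eq_bigr => p _.
by rewrite mulrDl cDl.
Qed.
HB.instance Definition _ := GRing.Zmodule_isLmodule.Build Q QM
  tens_scaleA tens_scale1 tens_scaleDr tens_scaleDl.

(* The canonical map M -> Q(R)M, an embedding when M is torsion-free. *)
Definition to_ext (m : M) : QM := tens (1 : Q) m.

(* 1 (x) phi, the image of phi in End_{Q(R)} (Q(R)M) *)
Definition ext_map (phi : {linear M -> M}) (x : QM) : QM :=
  \sum_(p <- repr x) tens p.1 (phi p.2).

Lemma ext_map_tens phi q m : ext_map phi (tens q m) = tens q (phi m).
Proof.
have [tDl tDr tZ] := tens_balanced Q M.
rewrite /ext_map -[LHS]/(bsum (fun q m => tens q (phi m)) _) bsum_repr.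
  by rewrite /bsum big_seq1.
by split=> *; rewrite ?linearD ?linearZ ?tDl ?tDr ?tZ.
Qed.

End ScalarExtension.

Definition reduced (R : comPzRingType) :=
  forall (x : R) (n : nat), x ^+ n = 0 -> x = 0.

Definition fg_submod (R : comPzRingType) (V : lmodType R) (N : set V) :=
  exists (n : nat) (e : 'I_n -> V),
    N = [set x | exists c : 'I_n -> R, x = \sum_i c i *: e i].

(* Ideals of R are the submodules of the regular module R^o. *)
Definition noetherian (R : comPzRingType) :=
  forall I : set R^o, submod_closed (mem I) -> fg_submod I.

Definition faithful (R : comPzRingType) (M : lmodType R) :=
  forall r : R, (forall m : M, r *: m = 0) -> r = 0.

Definition torsion_free (R : comPzRingType) (M : lmodType R) :=
  forall (s : R) (m : M), GRing.lreg s -> s *: m = 0 -> m = 0.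

Section Overrings.
Variables (R : comPzRingType) (M : lmodType R).
Local Notation Q := (tquot R).

Definition overring (S : set Q) :=
  subring_closed (mem S) /\ range (@to_tquot R) `<=` S.

(* SM: finite sums of products s m, computed in Q(R)M *)
Definition mul_ext (S : set Q) : set (tensor Q M) :=
  [set x | exists2 l : seq (Q * M), (forall p, p \in l -> S p.1) &
             x = \sum_(p <- l) p.1 *: to_ext p.2].

(* M carries an S-module structure extending its R-module structure; only the
   values of [act] on S matter. *)
Definition module_over (S : set Q) :=
  exists act : Q -> M -> M,
    [/\ forall s t m, S s -> S t -> act (s + t) m = act s m + act t m,
        forall s t m, S s -> S t -> act (s * t) m = act s (act t m),
        forall s m m', S s -> act s (m + m') = act s m + act s m' &
        forall r m, act (to_tquot r) m = r *: m].

Definition central (phi : {linear M -> M}) :=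
  forall psi : {linear M -> M}, phi \o psi =1 psi \o phi.

(* phi in End_R M and q in Q(R) define the same endomorphism of Q(R)M *)
Definition same_ext (phi : {linear M -> M}) (q : Q) :=
  forall x : tensor Q M, ext_map phi x = q *: x.

Definition centre : set Q :=
  [set q | exists2 phi : {linear M -> M}, central phi & same_ext phi q].

End Overrings.

Arguments same_ext {R M} phi q.
Arguments module_over {R} M S.
Arguments mul_ext {R} M S.
Arguments centre {R} M.

Definition is_largest (T : Type) (P : set T -> Prop) (C : set T) :=
  P C /\ forall S, P S -> S `<=` C.

(* Main.v *)
From HB Require Import structures.
Require Import Defs.
From mathcomp Require Import all_boot all_algebra.
From mathcomp Require Import ring.
From mathcomp Require Import boolp classical_sets.

(** Let r M <> 0. Since M is torsionless (a partial functional on M extends to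
    M after multiplication by a regular element), r does not kill the trace
    ideal of M; so the trace ideal is faithful, and in a reduced noetherian ring
    a faithful ideal contains a regular element s = sum_i f_i(m_i). A central
    endomorphism phi commutes with every m |-> f(m) y, so that
    s phi(y) = (sum_i f_i(phi(m_i))) y: phi is multiplication by an element of
    Q(R) with denominator s. Conversely any q in Q(R) with q M <= M is central,
    so the centre is {q | q M <= M}. No minimal primes are needed: the regular
    elements come from the ascending chain condition. *)

Set Implicit Arguments.
Unset Strict Implicit.
Unset Printing Implicit Defensive.

Import GRing.Theory.
Local Open Scope ring_scope.
Local Open Scope classical_set_scope.

(** * Submodules given as sets *)

Lemma mem_submod (R : comPzRingType) (V : lmodType R) (N : set V) :
  N 0 -> (forall a u v, N u -> N v -> N (a *: u + v)) -> submod_closed (mem N).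
Proof.
move=> N0 ND; split; first exact: (mem_set N0).
by move=> a u v /(@set_mem _ N u) Nu /(@set_mem _ N v) Nv; apply/mem_set/ND.
Qed.

Lemma submod0 (R : comPzRingType) (V : lmodType R) (N : set V) :
  submod_closed (mem N) -> N 0.
Proof. by case=> /(@set_mem _ N 0). Qed.

Lemma submodD (R : comPzRingType) (V : lmodType R) (N : set V) a u v :
  submod_closed (mem N) -> N u -> N v -> N (a *: u + v).
Proof. by case=> _ h Nu Nv; apply: (set_mem (h a u v _ _)); apply/mem_set. Qed.

Lemma submod_sum (R : comPzRingType) (V : lmodType R) (N : set V) n
    (c : 'I_n -> R) (e : 'I_n -> V) :
  submod_closed (mem N) -> (forall i, N (e i)) -> N (\sum_i c i *: e i).
Proof.
move=> Nsub Ne; elim/big_rec: _ => [|i x _ Nx]; first exact: submod0.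
exact: submodD.
Qed.

Lemma fg_submod_gen (R : comPzRingType) (V : lmodType R) (N : set V) n
    (e : 'I_n -> V) :
  N = [set x | exists c : 'I_n -> R, x = \sum_i c i *: e i] ->
  forall i, N (e i).
Proof.
move=> -> i /=; exists (fun j => (j == i)%:R).
rewrite (bigD1 i) //= eqxx scale1r big1 ?addr0 // => j /negPf ->.
by rewrite scale0r.
Qed.

(** * Annihilators and regular elements in reduced noetherian rings *)

Section ReducedNoetherian.
Variable R : comPzRingType.

(** The union of the chain is an ideal; its finitely many generators all lie in one stage, so the
    chain stops there. *)
Lemma noetherian_acc (F : nat -> set R^o) : noetherian R ->
    (forall n, submod_closed (mem (F n))) -> (forall n, F n `<=` F n.+1) ->
  exists n, F n.+1 `<=` F n.
Proof.
move=> Rnoeth Fsub FS.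
have Fle m n : (m <= n)%N -> F m `<=` F n.
  move=> /subnK <-; elim: (n - m)%N => [|k IHk] x Fx; rewrite ?add0n ?addSn //.
  exact/FS/IHk.
have [|n [e eE]] := Rnoeth [set x | exists n, F n x].
  apply: mem_submod; first by exists 0%N; apply: submod0.
  move=> a u v [m Fu] [n Fv]; exists (maxn m n).
  by apply: submodD => //; [apply: Fle Fu|apply: Fle Fv];
    rewrite ?leq_maxl ?leq_maxr.
have /choice [k Fk] : forall i, exists k, F k (e i).
  by move=> i; apply: (fg_submod_gen eE i).
exists (\max_i k i)%N => x Fx.
have [c ->] : [set x | exists c, x = \sum_i c i *: e i] x.
  by rewrite -eE; exists (\max_i k i).+1.
by apply: submod_sum => // i; apply: Fle (Fk i); apply: leq_bigmax.
Qed.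

Hypotheses (Rred : reduced R) (Rnoeth : noetherian R).

Lemma reduced_sqr (x : R) : x * x = 0 -> x = 0.
Proof. by rewrite -expr2; apply: Rred. Qed.

(** The square of [c * a] is [c * (a + b) * (c * a)] minus a multiple of [a * b], hence zero; the
    same goes for [c * b]. *)
Lemma reduced_orthD (a b c : R) :
  a * b = 0 -> c * (a + b) = 0 -> c * a = 0 /\ c * b = 0.
Proof.
move=> ab0 cab0.
have cc (u v : R) : u * v = 0 -> c * (u + v) = 0 -> c * u = 0.
  move=> uv0 cuv0; apply: reduced_sqr.
  transitivity (c * (u + v) * (c * u) - c * c * (u * v)); first by ring.
  by rewrite cuv0 uv0; ring.
split; first exact: cc cab0.
by apply: (cc b a); [rewrite mulrC|rewrite addrC].
Qed.

(* A b in I with minimal annihilator will do: if d b = 0 but d c <> 0, then b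
   and d c are orthogonal and b + d c has a smaller annihilator. The descending
   chain condition on annihilators comes from taking annihilators again. *)
Lemma exists_same_annihilator (I : set R^o) : submod_closed (mem I) ->
  exists2 b : R, I b & forall c d : R, I c -> d * b = 0 -> d * c = 0.
Proof.
move=> Isub; apply: contrapT => noI.
have step (b : {b : R | I b}) : exists b' : {b : R | I b},
    (forall d, d * sval b' = 0 -> d * sval b = 0) /\
    exists2 d, d * sval b = 0 & d * sval b' <> 0.
  case: b => b Ib /=; apply: contrapT => nob; apply: noI; exists b => // c d Ic.
  move=> db0; apply: contrapT => dc0; apply: nob.
  have Ib' : I (b + d * c) by rewrite addrC; apply: submodD.
  exists (exist _ _ Ib') => /=.
  have orth : b * (d * c) = 0 by rewrite mulrA [b * d]mulrC db0 mul0r.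
  split=> [d' /(reduced_orthD orth)[]//|]; exists (d * c).
    by rewrite mulrC.
  by move=> /(reduced_orthD orth)[_ /reduced_sqr].
have /choice [f fP] := step.
pose b n := sval (iter n f (exist _ 0 (submod0 Isub))).
have [|n x|n le] := @noetherian_acc
    (fun n => [set x : R | forall d, d * b n = 0 -> d * x = 0]) Rnoeth.
- move=> n; apply: mem_submod => [d _|a u v u0 v0 d db0]; first exact: mulr0.
  by rewrite mulrDr v0 // addr0 -[a *: u]/(a * u) mulrCA u0 // mulr0.
- move=> /= x0 d db0; apply: x0; exact: (fP _).1 _ db0.
(* [b n.+1] lies in its own double annihilator, hence in that of [b n] by stationarity; so every [d]
   that kills [b n] kills [b n.+1], against the choice of [f]. *)
have [d db0 /(_ _)] := (fP (iter n f (exist _ 0 (submod0 Isub)))).2.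
by apply; apply: le db0 => d'.
Qed.

(** An element with the same annihilator as a faithful ideal is killed by zero only. *)
Lemma exists_lreg_faithful_ideal (I : set R^o) : submod_closed (mem I) ->
    (forall d : R, (forall c : R, I c -> d * c = 0) -> d = 0) ->
  exists2 s : R, I s & GRing.lreg s.
Proof.
move=> Isub Ifaith; have [s Is sP] := exists_same_annihilator Isub.
exists s => // x y /eqP; rewrite -subr_eq0 -mulrBr mulrC => /eqP xys.
by apply/eqP; rewrite -subr_eq0; apply/eqP/Ifaith => c Ic; apply: sP xys.
Qed.

(* The element a generates, up to torsion, a complement of I in R. *)
Lemma exists_quasi_complement (I : set R^o) : submod_closed (mem I) ->
  exists a b : R, [/\ I b, forall c : R, I c -> a * c = 0 &
                      GRing.lreg (a + b)].
Proof.
move=> Isub; have [b Ib bP] := exists_same_annihilator Isub.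
have Asub : submod_closed (mem [set a : R^o | a * b = 0]).
  apply: mem_submod => /= [|r u v u0 v0]; first exact: mul0r.
  by rewrite mulrDl v0 addr0 -[r *: u]/(r * u) -mulrA u0 mulr0.
have [a /= ab0 aP] := exists_same_annihilator Asub.
exists a, b; split=> [//|c Ic|]; first exact: bP.
move=> x y /eqP; rewrite -subr_eq0 -mulrBr mulrC => /eqP.
case/(reduced_orthD ab0) => za zb; apply/eqP; rewrite -subr_eq0; apply/eqP.
(* The difference [x - y] kills [b], so it lies in the annihilator of [b]; it kills [a], so it kills
   that whole annihilator, itself included. *)
by apply: reduced_sqr; apply: aP.
Qed.

End ReducedNoetherian.

(** * Extension of partial functionals up to a regular factor *)

Section Functionals.
Variables (R : comPzRingType) (M : lmodType R).
Hypotheses (Rred : reduced R) (Rnoeth : noetherian R).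

(* The graph of a linear functional on a submodule of M. *)
Definition functional_graph (G : set (M * R^o)) :=
  submod_closed (mem G) /\ forall y : R, G (0, y) -> y = 0.

Lemma functional_graph_eq (G : set (M * R^o)) (m : M) (x y : R) :
  functional_graph G -> G (m, x) -> G (m, y) -> x = y.
Proof.
move=> [Gsub G0] Gx Gy; apply/eqP; rewrite -subr_eq0; apply/eqP/G0.
have := submodD (-1) Gsub Gy Gx; congr G.
by congr (_, _) => /=; rewrite scaleN1r ?addNr // addrC.
Qed.

(* With I the ideal of the r such that r e is in the domain, and a, b as in
   exists_quasi_complement, a + b times the functional extends to e with the
   value taken by the original functional at b e. *)
Lemma functional_graph_extend (G : set (M * R^o)) (e : M) :
    functional_graph G ->
  exists (G' : set (M * R^o)) (s : R),
    [/\ functional_graph G', GRing.lreg s,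
        forall (m : M) (y : R), G (m, y) -> G' (m, s * y) &
        exists w : R, G' (e, w)].
Proof.
move=> Gfun; have [Gsub G0] := Gfun.
have Isub : submod_closed (mem [set r : R^o | exists y : R, G (r *: e, y)]).
  apply: mem_submod; first by exists 0; rewrite scale0r; apply: submod0 Gsub.
  move=> c u v [y Gy] [z Gz]; exists (c * y + z).
  have := submodD c Gsub Gy Gz; congr G; congr (_, _).
  by rewrite scalerDl -scalerA.
have [a [b [[w Gw] aI abreg]]] := exists_quasi_complement Rred Rnoeth Isub.
exists [set p | exists m y r,
  G (m, y) /\ p = (m + r *: e, (a + b) * y + r * w)], (a + b).
split=> //.
- split=> [|z [m [y [r [Gy [e0 ->]]]]]].
    apply: mem_submod => /=.
      exists 0, 0, 0; split; first exact: (submod0 Gsub).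
      by rewrite scale0r mulr0 mul0r !addr0.
    move=> c _ _ [m [y [r [Gy ->]]]] [m' [y' [r' [Gy' ->]]]].
    exists (c *: m + m'), (c * y + y'), (c * r + r').
    split; first exact: (submodD c Gsub Gy Gy').
    congr (_, _) => /=.
      by rewrite scalerDr scalerDl !scalerA addrACA.
    by rewrite -[c *: _]/(c * _); ring.
  (* Here [m + r *: e] is zero, so [r] is in the ideal and [a] kills [r]. The value at [r *: e] is
     [- y], whence [a * y = 0]; computing the value at [(b * r) *: e] in two ways gives
     [- b * y = r * w]. *)
  have reE : r *: e = - m by apply/eqP; rewrite -addr_eq0 addrC -e0.
  have Gr : G (r *: e, - y).
    have := submodD (-1) Gsub Gy (submod0 Gsub); congr G.
    by rewrite addr0 reE; congr (_, _); rewrite /= scaleN1r.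
  have ar0 : a * r = 0 by apply: aI; exists (- y).
  have ay0 : a * y = 0.
    apply: G0; have := submodD (- a) Gsub Gr (submod0 Gsub); congr G.
    rewrite addr0; congr (_, _) => /=.
      by rewrite scalerA mulNr ar0 oppr0 scale0r.
    by rewrite -[_ *: _]/(_ * _) mulrNN.
  have by_rw : b * (- y) = r * w.
    apply: (functional_graph_eq (m := (b * r) *: e) Gfun).
      have := submodD b Gsub Gr (submod0 Gsub); congr G.
      by rewrite addr0; congr (_, _); rewrite /= scalerA.
    have := submodD r Gsub Gw (submod0 Gsub); congr G.
    by rewrite addr0; congr (_, _); rewrite /= scalerA mulrC.
  by rewrite -by_rw mulrDl ay0; ring.
- move=> m y Gy; exists m, y, 0; split=> //.
  by rewrite scale0r mul0r !addr0.
- exists w, 0, 0, 1; split; first exact: (submod0 Gsub).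
  by rewrite scale1r mulr0 mul1r !add0r.
Qed.

(** Meant for a list of generators of M: a domain containing them is all of M. The regular factors
    multiply. *)
Lemma functional_graph_extend_seq (G : set (M * R^o)) (l : seq M) :
    functional_graph G ->
  exists (G' : set (M * R^o)) (s : R),
    [/\ functional_graph G', GRing.lreg s,
        forall (m : M) (y : R), G (m, y) -> G' (m, s * y) &
        forall e, e \in l -> exists w : R, G' (e, w)].
Proof.
move=> Gfun; elim: l => [|e l [G1 [s [G1fun sreg G1P G1l]]]].
  by exists G, 1; split=> // [|m y]; [apply: lreg1|rewrite mul1r].
have [G2 [t [G2fun treg G2P G2e]]] := functional_graph_extend e G1fun.
exists G2, (t * s); split=> // [|m y Gy|e'].
- exact: lregM.
- by rewrite -mulrA; apply/G2P/G1P.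
- rewrite in_cons => /orP[/eqP -> //|/G1l[w G1w]].
  by exists (t * w); apply: G2P.
Qed.

(** Take [a] from a quasi-complement of the annihilator of [x]. As [a] kills that annihilator, r x
    |-> r a is well defined on R x; some regular multiple of it extends to all of M. *)
Lemma torsion_free_torsionless (x : M) :
    fg_submod [set: M] -> torsion_free M -> x <> 0 ->
  exists f : {scalar M}, f x <> 0.
Proof.
move=> [n [g gE]] Mtf x0.
have Isub : submod_closed (mem [set r : R^o | r *: x = 0]).
  apply: mem_submod => [|c u v u0 v0]; first exact: scale0r.
  by rewrite /= scalerDl v0 addr0 -scalerA u0 scaler0.
have [a [b [bx0 aI abreg]]] := exists_quasi_complement Rred Rnoeth Isub.
(* Otherwise [b] would be regular and kill [x]. *)
have a0 : a <> 0.
  by move=> a0; apply/x0/(Mtf _ _ abreg); rewrite a0 add0r.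
pose G : set (M * R^o) := [set p | exists r : R, p = (r *: x, r * a)].
have Gfun : functional_graph G.
  split.
    apply: mem_submod => [|c _ _ [r ->] [r' ->]].
      by exists 0; rewrite scale0r mul0r.
    by exists (c * r + r'); rewrite scalerDl mulrDl -scalerA -mulrA.
  by move=> y [r [rx0 ->]]; rewrite mulrC aI.
have [G' [s [G'fun sreg G'P G'g]]] :=
  functional_graph_extend_seq [seq g i | i <- enum 'I_n] Gfun.
have [G'sub _] := G'fun.
have /choice [f fP] : forall m, exists y : R, G' (m, y).
  move=> m; have [c ->] : [set x | exists c, x = \sum_i c i *: g i] m.
    by rewrite -gE.
  have /choice [w wP] : forall i, exists w : R, G' (g i, w).
    by move=> i; apply/G'g/map_f; rewrite mem_enum.
  exists (\sum_i c i *: (w i : R^o)).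
  have := submod_sum c G'sub wP; congr G'.
  elim/big_rec3: _ => [//|i u v p _ ->]; congr (_, _).
have flin : scalar f.
  move=> c u v; apply: functional_graph_eq G'fun (fP _) _.
  exact: submodD G'sub (fP u) (fP v).
pose F : {scalar M} := HB.pack f (GRing.isLinear.Build R M R *%R f flin).
exists F => /= fx0; apply: a0.
(* The value of [F] at [x] is [s * a], with [s] regular. *)
apply: sreg; rewrite mulr0 -fx0.
apply: functional_graph_eq G'fun (G'P _ _ _) (fP x).
by exists 1; rewrite scale1r mul1r.
Qed.

End Functionals.

(** * The canonical map from M to Q(R)M *)

Section Extension.
Variables (R : comPzRingType) (M : lmodType R).
Local Notation Q := (tquot R).
Local Notation QM := (tensor Q M).

Lemma to_extD (m m' : M) : to_ext (m + m') = to_ext m + to_ext m'.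
Proof. by case: (tens_balanced Q M) => _ tD _; apply: tD. Qed.

Lemma tens_scalel (q q' : Q) (m : M) : q *: tens q' m = tens (q * q') m.
Proof. by rewrite -[LHS]/(tens_scale _ _) tens_scale_pi. Qed.

Lemma tens_to_ext (q : Q) (m : M) : tens q m = q *: to_ext m.
Proof. by rewrite /to_ext tens_scalel mulr1. Qed.

Lemma to_extZ (r : R) (m : M) : to_ext (r *: m) = to_tquot r *: to_ext m.
Proof.
have [_ _ tZ] := tens_balanced Q M.
by rewrite -tens_to_ext /to_ext -tZ; congr (tens _ m); apply: mulr1.
Qed.

Lemma to_ext0 : to_ext (0 : M) = 0.
Proof. by apply: (@addrI _ (to_ext 0)); rewrite -to_extD !addr0. Qed.

Lemma to_extB (m m' : M) : to_ext (m - m') = to_ext m - to_ext m'.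
Proof. by rewrite -scaleN1r to_extD to_extZ rmorphN1 scaleN1r. Qed.

(** The image of M generates Q(R)M over Q(R). *)
Lemma same_extP (phi : {linear M -> M}) (q : Q) :
  same_ext phi q <-> forall m, to_ext (phi m) = q *: to_ext m.
Proof.
split=> [phiq m|phiq x]; first by rewrite -phiq ext_map_tens.
rewrite -[x in RHS]reprK -bsum_tens /ext_map /bsum scaler_sumr.
apply: eq_bigr => p _.
by rewrite !tens_to_ext phiq !scalerA mulrC.
Qed.

(** The functional extends to Q(R)M, with values in Q(R), by sending [tens q m] to
    [q * to_tquot (f m)]. *)
Lemma scalar_to_ext_neq0 (f : {scalar M}) (x : M) : f x <> 0 -> to_ext x <> 0.
Proof.
move=> fx0 x0; apply: fx0; apply: (@to_tquot_inj R); rewrite rmorph0.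
have bf : balanced (fun (q : Q) (m : M) => q * to_tquot (f m)).
  split=> [q q' m|q m m'|r q m]; first by rewrite mulrDl.
    by rewrite linearD rmorphD mulrDr.
  by rewrite linearZ rmorphM -[r *: q]/(to_tquot r * q) mulrCA mulrA.
have [g [[gD gt] _]] := tens_univ bf.
rewrite -[LHS]mul1r -gt -[tens _ _]/(to_ext x) x0.
by apply: (@addrI _ (g 0)); rewrite -gD !addr0.
Qed.

(** * Embedding of M in Q(R)M, and the centre inside Q(R) *)

Hypotheses (Rred : reduced R) (Rnoeth : noetherian R).
Hypotheses (Mfg : fg_submod [set: M]) (Mfaithful : faithful M).
Hypothesis (Mtf : torsion_free M).

Lemma to_ext_inj : injective (@to_ext R M).
Proof.
move=> x y xy; apply/eqP; rewrite -subr_eq0; apply/eqP; apply: contrapT => xy0.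
have [f /scalar_to_ext_neq0] :=
  torsion_free_torsionless Rred Rnoeth Mfg Mtf xy0.
by apply; rewrite to_extB xy subrr.
Qed.

(** Clearing the denominator of [q - q'] leaves an element of R that kills M. *)
Lemma tquot_faithful (q q' : Q) :
  (forall m : M, q *: to_ext m = q' *: to_ext m) -> q = q'.
Proof.
move=> qq'; have [a [s [sreg sq]]] := tquotP (q - q').
have [u su] := to_tquot_reg sreg.
have a0 : a = 0.
  apply: Mfaithful => m; apply: to_ext_inj.
  by rewrite to_extZ -sq -scalerA scalerBl qq' subrr scaler0 to_ext0.
apply/eqP; rewrite -subr_eq0; apply/eqP.
by rewrite -[LHS]mul1r -su mulrAC sq a0 rmorph0 mul0r.
Qed.

Lemma centreP (q : Q) :
  centre M q <-> forall m : M, exists m', to_ext m' = q *: to_ext m.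
Proof.
split=> [[phi _ /same_extP phiq] m|/choice[phi phiq]]; first by exists (phi m).
have philin : linear phi.
  move=> r u v; apply: to_ext_inj.
  rewrite to_extD to_extZ !phiq to_extD to_extZ scalerDr.
  by rewrite !scalerA mulrC.
pose F : {linear M -> M} :=
  HB.pack phi (GRing.isLinear.Build R M M *:%R phi philin).
exists F; last exact/same_extP.
(* Write q = a / s: then [s *: phi m] is [a *: m], so [phi] commutes with every [psi] after
   multiplication by [s], which torsion-freeness cancels. *)
have [a [s [sreg sq]]] := tquotP q.
have sphi m : s *: phi m = a *: m.
  by apply: to_ext_inj; rewrite !to_extZ phiq scalerA sq.
move=> psi m /=; apply/eqP; rewrite -subr_eq0; apply/eqP/(Mtf sreg).
by rewrite scalerBr sphi -!linearZ /= sphi subrr.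
Qed.

(* The endomorphisms m |-> f(m) y, for f in the dual of M, commute with phi:
   f(m) phi(y) = f(phi(m)) y. So the trace ideal of M is contained in the ideal
   below, and it is faithful because M is torsionless. *)
Lemma central_common_denominator :
  exists2 s : R, GRing.lreg s & forall phi : {linear M -> M}, central phi ->
    exists a : R, forall y, s *: phi y = a *: y.
Proof.
pose T : set R^o := [set s | forall phi : {linear M -> M}, central phi ->
    exists a : R, forall y, s *: phi y = a *: y].
suff [s Ts sreg] : exists2 s : R, T s & GRing.lreg s by exists s.
apply: (exists_lreg_faithful_ideal Rred Rnoeth) => [|d dT].
  apply: mem_submod => [phi _|c u v Tu Tv phi phic].
    by exists 0 => y; rewrite !scale0r.
  have [[a ua] [b vb]] := (Tu _ phic, Tv _ phic).
  by exists (c * a + b) => y; rewrite !scalerDl -!scalerA ua vb.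
apply: Mfaithful => m; apply: contrapT => dm0.
have [f] := torsion_free_torsionless Rred Rnoeth Mfg Mtf dm0.
(* Since [d] kills [T], it is enough that [f m] lies in [T]. *)
rewrite linearZ; apply; apply: dT => phi phic; exists (f (phi m)) => y.
have rlin : linear (fun m => f m *: y).
  by move=> c u v; rewrite linearP scalerDl -scalerA.
pose rank1 : {linear M -> M} :=
  HB.pack (fun m => f m *: y) (GRing.isLinear.Build R M M *:%R _ rlin).
by have := phic rank1 m; rewrite /= linearZ.
Qed.

Lemma central_same_ext (phi : {linear M -> M}) :
  central phi -> exists q : Q, same_ext phi q.
Proof.
have [s sreg sP] := central_common_denominator.
move=> /sP[a phia]; have [u su] := to_tquot_reg sreg.
(* This is the fraction a / s, [u] being the inverse of [s] in Q(R). *)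
exists (u * to_tquot a); apply/same_extP => m.
by rewrite -scalerA -to_extZ -phia to_extZ scalerA mulrC su scale1r.
Qed.

Lemma overring_centre : overring (centre M).
Proof.
split=> [|_ [r _ <-]]; last first.
  by apply/centreP => m; exists (r *: m); rewrite to_extZ.
split.
- apply/(@mem_set _ (centre M))/centreP => m.
  by exists m; rewrite scale1r.
- move=> q q' /(@set_mem _ (centre M))/centreP Cq
    /(@set_mem _ (centre M))/centreP Cq'.
  apply/(@mem_set _ (centre M))/centreP => m.
  have [[u um] [v vm]] := (Cq m, Cq' m); exists (u - v).
  by rewrite to_extB um vm scalerBl.
- move=> q q' /(@set_mem _ (centre M))/centreP Cq
    /(@set_mem _ (centre M))/centreP Cq'.
  apply/(@mem_set _ (centre M))/centreP => m.
  have [v vm] := Cq' m; have [u um] := Cq v; exists u.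
  by rewrite um vm scalerA.
Qed.

Lemma submod_centre : submod_closed (mem (centre M : set Q)).
Proof.
apply: mem_submod => [|r q q' /centreP Cq /centreP Cq'].
  by apply/centreP => m; exists 0; rewrite scale0r to_ext0.
apply/centreP => m; have [[u um] [v vm]] := (Cq m, Cq' m); exists (r *: u + v).
by rewrite to_extD to_extZ um vm scalerDl scalerA.
Qed.

(* A common denominator s embeds the centre into R as an ideal. *)
Lemma fg_centre : fg_submod (centre M).
Proof.
have [s sreg sP] := central_common_denominator.
have sC q : centre M q -> exists a, to_tquot s * q = to_tquot a.
  move=> [phi /sP[a phia] /same_extP phiq]; exists a.
  apply: tquot_faithful => m.
  by rewrite -scalerA -phiq -!to_extZ phia.
have [|n [e eE]] :=
    @Rnoeth [set a : R | exists2 q, centre M q & to_tquot s * q = to_tquot a] _.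
  apply: mem_submod => [|c a b [q Cq qa] [q' Cq' qb]].
    by exists 0; [apply: submod0 submod_centre|rewrite rmorph0 mulr0].
  exists (to_tquot c * q + q'); first exact: (submodD c submod_centre).
  by rewrite mulrDr mulrCA qa qb -rmorphM -rmorphD.
have /choice [g gP] : forall i, exists q,
    centre M q /\ to_tquot s * q = to_tquot (e i : R).
  by move=> i; have [q] := fg_submod_gen eE i; exists q.
have [u su] := to_tquot_reg sreg.
exists n, g; apply/seteqP; split=> [q Cq|_ [c ->]].
  have [a qa] := sC q Cq.
  have [c ac] : [set x | exists c, x = \sum_i c i *: e i] a.
    by rewrite -eE; exists q.
  have aE : to_tquot a = \sum_i to_tquot (c i) * (to_tquot s * g i).
    rewrite ac (rmorph_sum (@to_tquot R)); apply: eq_bigr => i _.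
    by rewrite (gP i).2 -rmorphM.
  exists c; rewrite -[LHS]mul1r -su mulrAC qa aE mulr_suml.
  apply: eq_bigr => i _; rewrite -[RHS]/(to_tquot (c i) * g i).
  by rewrite -mulrA [_ * u]mulrAC su mul1r.
by apply: (submod_sum _ submod_centre) => i; apply: (gP i).1.
Qed.

(** * The centre as the largest overring acting on M *)

Lemma module_over_centre : module_over M (centre M).
Proof.
(* The default 0 is taken only where [q *: to_ext m] falls outside the image of M, which never
   happens for [q] in the centre. *)
pose act (q : Q) (m : M) : M := xget 0 [set m' | to_ext m' = q *: to_ext m].
have actP q m : centre M q -> to_ext (act q m) = q *: to_ext m.
  by move=> /centreP/(_ m)[m' m'P]; rewrite /act; case: xgetP => [//|/(_ m')].
have [[_ _ CM] CR] := overring_centre.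
exists act; split=> [q q' m Cq Cq'|q q' m Cq Cq'|q m m' Cq|r m].
- by apply: to_ext_inj; rewrite to_extD !actP ?scalerDl //;
    rewrite -[q]scale1r; apply: (submodD _ submod_centre).
- apply: to_ext_inj; rewrite !actP ?scalerA //.
  by apply/set_mem/CM; apply/mem_set.
- by apply: to_ext_inj; rewrite !(to_extD, actP) ?scalerDr.
- by apply: to_ext_inj; rewrite to_extZ actP //; apply: CR; exists r.
Qed.

(** The action of q = a / s is forced: [s] times [act q m] is [a *: m], and [s] is invertible in
    Q(R), so [act q m] is the product q m taken in Q(R)M. *)
Lemma module_over_sub_centre (S : set Q) :
  overring S -> module_over M S -> S `<=` centre M.
Proof.
move=> [_ SR] [act [actD actM actDr actR]] q Sq; apply/centreP => m.
exists (act q m); have [a [s [sreg sq]]] := tquotP q.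
have [u su] := to_tquot_reg sreg.
have SRr r : S (to_tquot r) by apply: SR; exists r.
suff e : to_tquot s *: to_ext (act q m) = to_tquot s *: (q *: to_ext m).
  by rewrite -[LHS]scale1r -[RHS]scale1r -su mulrC -!scalerA e.
by rewrite -to_extZ -actR -actM // scalerA sq actR to_extZ.
Qed.

Lemma mul_ext_centre : mul_ext M (centre M) = range (@to_ext R M).
Proof.
apply/seteqP; split=> [_ [l lC ->]|_ [m _ <-]].
  elim: l lC => [|p l IHl] lC.
    by exists 0; rewrite ?big_nil ?to_ext0.
  have [x lx|x _ xE] := IHl; first by apply: lC; rewrite in_cons lx orbT.
  have /centreP/(_ p.2)[m mE] := lC p (mem_head _ _).
  by exists (m + x); rewrite // big_cons to_extD mE xE.
exists [:: (1, m)] => [p|]; last by rewrite big_seq1 scale1r.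
rewrite inE => /eqP -> /=.
by apply/centreP => m'; exists m'; rewrite scale1r.
Qed.

Lemma mul_ext_sub_centre (S : set Q) :
  mul_ext M S = range (@to_ext R M) -> S `<=` centre M.
Proof.
move=> SM q Sq; apply/centreP => m.
have [m' _ m'E] : range (@to_ext R M) (q *: to_ext m).
  rewrite -SM; exists [:: (q, m)]; last by rewrite big_seq1.
  by move=> p; rewrite inE => /eqP ->.
by exists m'.
Qed.

End Extension.

Theorem theorem5p3 (R : comPzRingType) (M : lmodType R)
    (Rreduced : reduced R) (Rnoeth : noetherian R)
    (Mfg : fg_submod [set: M]) (Mfaithful : faithful M)
    (Mtf : torsion_free M) :
  [/\ forall phi : {linear M -> M}, central phi ->
        exists! q : tquot R, same_ext phi q,
      forall (phi psi : {linear M -> M}) (q : tquot R),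
        same_ext phi q -> same_ext psi q -> phi =1 psi,
      is_largest
        (fun S : set (tquot R) =>
           [/\ overring S, fg_submod S & module_over M S])
        (centre M) &
      is_largest
        (fun S : set (tquot R) =>
           overring S /\ mul_ext M S = range (@to_ext R M))
        (centre M)].
Proof.
have inj := to_ext_inj Rreduced Rnoeth Mfg Mtf.
have ovr := overring_centre Rreduced Rnoeth Mfg Mtf.
split.
- move=> phi phic.
  have [q phiq] := central_same_ext Rreduced Rnoeth Mfg Mfaithful Mtf phic.
  exists q; split=> // q' phiq'.
  apply: (tquot_faithful Rreduced Rnoeth Mfg Mfaithful Mtf) => m.
  by rewrite -phiq -phiq'.
- move=> phi psi q /same_extP phiq /same_extP psiq m.
  by apply: inj; rewrite phiq psiq.
- split=> [|S [Sring _ SM]]; last exact: module_over_sub_centre SM.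
  split=> //; first exact: fg_centre.
  exact: module_over_centre.
- split=> [|S [_ SM]]; last exact: mul_ext_sub_centre SM.
  by split=> //; exact: mul_ext_centre.
Qed.
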